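(* For every integer $n\ge 0$ the polynomial $P_n=P_{-2,n}(c)$ satisfies the following fourth order linear differential equation, where $'$ denotes differentiation with respect to $c$: $$16(c^2-1)^2P_n^{(iv)}+160c(c^2-1)P_n'''-8\left(c^2(n^2-4n-42)-n^2+4n+18\right)P_n''-24c(n^2-4n-2)P_n'+(n-6)(n-2)^2(n+2)P_n=0.$$
   Context: The polynomials $P_{-2,n}(c)$, $n\ge 0$, in the variable $c$ (complex coefficients) are defined by the initial conditions $P_{-2,2}(c)=1$, $P_{-2,0}(c)=P_{-2,1}(c)=P_{-2,3}(c)=0$ and the recursion $$(6+2k)P_{-2,k+4}(c)=4k\,c\,P_{-2,k+2}(c)-2(k-3)P_{-2,k}(c),\qquad k\ge 0.$$ Thus, for example, $P_{-2,4}=0$, $P_{-2,6}=\frac15$, $P_{-2,8}=\frac{8c}{35}$, $P_{-2,10}=\frac{32c^2-7}{105}$, and all odd-indexed polynomials vanish. Their generating function is $\sum_{n\ge0}P_{-2,n}(c)z^n=z\sqrt{1-2cz^2+z^4}\int\frac{1}{(z^4-2cz^2+1)^{3/2}}\,dz$. *)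

(* Defs.v *)
From mathcomp Require Import all_boot all_order all_algebra.
From mathcomp Require Import reals complex.

Set Implicit Arguments.
Unset Strict Implicit.
Unset Printing Implicit Defensive.

Import GRing.Theory Num.Theory.
Local Open Scope ring_scope.

(* Pm2 R n is P_{-2,n} over the complex numbers R[i], with variable c := 'X. *)
Fixpoint Pm2 (R : realType) (n : nat) : {poly R[i]} :=
  match n with
  | 0 | 1 | 3 => 0
  | 2 => 1
  | ((k.+2) as k2).+2 =>
      (6 + 2 * k%:R)^-1 *:
        ((4 * k%:R) *: ('X * Pm2 R k2) - (2 * (k%:R - 3)) *: Pm2 R k)
  end.

Lemma Pm2_init (R : realType) :
  [/\ Pm2 R 2 = 1, Pm2 R 0 = 0, Pm2 R 1 = 0 & Pm2 R 3 = 0].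
Proof. by []. Qed.

Lemma Pm2_rec (R : realType) (k : nat) :
  (6 + 2 * k%:R) *: Pm2 R (k + 4) =
    (4 * k%:R) *: ('X * Pm2 R (k + 2)) - (2 * (k%:R - 3)) *: Pm2 R k.
Proof.
have k_neq0 : 6 + 2 * k%:R != 0 :> R[i].
  by rewrite -natrM -natrD pnatr_eq0.
by rewrite addn4 addn2 [Pm2 R k.+4]/= scalerA mulfV // scale1r.
Qed.

(* Main.v *)
Require Import Defs.
From mathcomp Require Import all_boot all_order all_algebra.
From mathcomp Require Import reals complex.
From mathcomp Require Import ring.

Set Implicit Arguments.
Unset Strict Implicit.
Unset Printing Implicit Defensive.

Import GRing.Theory Num.Theory.
Local Open Scope ring_scope.

(** The recursion for [Pm2] is, up to reindexing, the Gegenbauer recursion of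
parameter [-1/2] taken at half-integer degrees.  Its solutions [u], functions
of [c], therefore obey contiguity relations expressing [(1 - c^2) u_n'] through
[c u_n] and [u_(n+2)], or through [c u_n] and [u_(n-2)].  The polynomial [Pm2]
is a combination of two such solutions, but with coefficients that depend on
[c], because its initial values are prescribed; these coefficients are again,
up to a factor [1 - c^2], solutions at a fixed index.  So [Pm2] lives in a
space of dimension [2 * 2 = 4] over the rational functions of [c], which is
where the order of the equation comes from.

For even [n], that space is spanned by [p_n = Pm2 n], [p_(n+2)], [s_n]
and [s_(n+2)], where [s = Pm4] is the solution of the same recursion with
initial values [1, 0, 0, 0].  The contiguity relations turn into a first order
linear system in these four polynomials, [contiguous], which the recursion
propagates from [n] to [n + 2] ([contiguous_step]).  Eliminating [p_(n+2)] and
[s_(n+2)] leaves two second order equations of Gegenbauer type that couple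
[p = p_n] to [s = s_n] ([contiguous_ode_p] and [contiguous_ode_s]):
    [4 (1 - c^2) p'' - 4 c p' + (n - 2)^2 p = 4 s'],
    [4 (1 - c^2) s'' - 12 c s' + n (n - 4) s = 12 p'].
The derivative of the second one involves [s] only through [s'], and the first
one gives [s'] in terms of [p]: substituting yields the fourth order
equation. *)

(** * Linear combinations of equations *)

(** Most identities below are consequences of explicit linear combinations of
known equations, and the notations below let a proof display the
coefficients. *)
Section LinearCombination.

Variable A : pzRingType.
Implicit Types x y l r a : A.

Lemma scale_eq a l r : l = r -> a * l = a * r.
Proof. by move->. Qed.

Lemma add_eq l r x y : l = r -> x = y -> l + x = r + y.
Proof. by move=> -> ->. Qed.

Lemma eq_by_combination l r x y : l = r -> x - y = l - r -> x = y.
Proof. by move=> ->; rewrite subrr => /eqP; rewrite subr_eq0 => /eqP. Qed.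

End LinearCombination.

Local Notation "a *e h" := (scale_eq a h) (at level 40, h at level 39).
Local Notation "h +e k" := (add_eq h k) (at level 50, left associativity).

Lemma deriv_natr (A : nzRingType) (m : nat) : (m%:R : {poly A})^`() = 0.
Proof. by rewrite -polyC_natr derivC. Qed.

(** * The first order system *)

Section Contiguity.

Variable F : numFieldType.
Implicit Types (n : nat) (p q r s t u : {poly F}).

(** Half of the recursion, with its coefficients moved into the polynomial
ring, so that all later identities are identities of commutative rings. *)
Definition recurrence n p q r :=
  (n%:R + 3) * r = 2 * n%:R * 'X * q - (n%:R - 3) * p.

Lemma polynat_neq0 n : (n.+1%:R : {poly F}) != 0.
Proof. by rewrite -polyC_natr polyC_eq0 pnatr_eq0. Qed.

Lemma recurrence_of_scale n p q r :
  (6 + 2 * n%:R) *: r = (4 * n%:R) *: ('X * q) - (2 * (n%:R - 3)) *: p ->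
  recurrence n p q r.
Proof.
rewrite -!mul_polyC !(rmorphD, rmorphB, rmorphM, rmorph_nat) /= => rec.
apply: (mulfI (polynat_neq0 1)).
by apply: (eq_by_combination rec); ring.
Qed.

(** The four polynomials stand for [p_n], [p_(n+2)], [s_n], [s_(n+2)].  They
are the contiguity relations of Gegenbauer functions [u_n], corrected for the
[c]-dependent coefficients in front of these functions: differentiating the
coefficients shifts the diagonal terms and adds the last term, which couples
the two sequences. *)
Definition contiguous n p q s t :=
  [/\ 2 * (1 - 'X ^+ 2) * p^`() = (n%:R - 2) * 'X * p - (n%:R + 1) * q + s,
      2 * (1 - 'X ^+ 2) * s^`() = n%:R * 'X * s - (n%:R + 1) * t + 3 * p,
      2 * (1 - 'X ^+ 2) * q^`() = - (n%:R * 'X * q) + (n%:R - 3) * p + t &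
      2 * (1 - 'X ^+ 2) * t^`() =
        - ((n%:R - 2) * 'X * t) + (n%:R - 3) * s + 3 * q].

Lemma recurrence_deriv n p q r : recurrence n p q r ->
  (n%:R + 3) * r^`() =
    2 * n%:R * q + 2 * n%:R * 'X * q^`() - (n%:R - 3) * p^`().
Proof.
move=> /(congr1 (@deriv F)); rewrite !(derivE, deriv_natr) => rec'.
by apply: (eq_by_combination rec'); ring.
Qed.

(** The first two relations at [n + 2] are the last two at [n], rewritten by
the recursion.  The last two come from differentiating the recursion and
using the relations at [n]. *)
Lemma contiguous_step n p q r s t u :
  recurrence n p q r -> recurrence n s t u ->
  contiguous n p q s t -> contiguous n.+2 q r t u.
Proof.
move=> rec_p rec_s [Dp Ds Dq Dt].
have Dr := recurrence_deriv rec_p; have Du := recurrence_deriv rec_s.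
have n3_neq0 : n%:R + 3 != 0 :> {poly F} by rewrite -natrD addn3 polynat_neq0.
rewrite /recurrence in rec_p rec_s; split.
- by apply: (eq_by_combination (Dq +e 1 *e rec_p)); ring.
- by apply: (eq_by_combination (Dt +e 1 *e rec_s)); ring.
- apply: (mulfI n3_neq0); apply: (eq_by_combination
    ((2 * (1 - 'X ^+ 2)) *e Dr +e (2 * n%:R * 'X) *e Dq +e (3 - n%:R) *e Dp
      +e ((n%:R + 2) * 'X) *e rec_p +e -1 *e rec_s)).
  by ring.
- apply: (mulfI n3_neq0); apply: (eq_by_combination
    ((2 * (1 - 'X ^+ 2)) *e Du +e (2 * n%:R * 'X) *e Dt +e (3 - n%:R) *e Ds
      +e (n%:R * 'X) *e rec_s +e -3 *e rec_p)).
  by ring.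
Qed.

(** * Elimination *)

Lemma one_sub_X2_neq0 : 2 * (1 - 'X ^+ 2) != 0 :> {poly F}.
Proof.
rewrite mulf_neq0 ?polynat_neq0 // -oppr_eq0 opprB -polyC1.
by rewrite -size_poly_eq0 size_XnsubC.
Qed.

Section Elimination.

Variables (n : nat) (p q s t : {poly F}).
Hypothesis contig : contiguous n p q s t.

(** Differentiating the relation for [p'] produces [q'], which the relation
for [q'] trades for [p], [q] and [t].  Both [q] and [t] then cancel against
the relations for [p'] and [s'], and what remains is divisible by
[1 - c^2]. *)
Lemma contiguous_ode_p :
  4 * (1 - 'X ^+ 2) * p^`(2) - 4 * 'X * p^`() + (n%:R - 2) ^+ 2 * p
    = 4 * s^`().
Proof.
case: contig => [Dp Ds Dq Dt].
have := congr1 (@deriv F) Dp; rewrite !(derivE, deriv_natr) /= => DDp.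
apply: (mulfI one_sub_X2_neq0); apply: (eq_by_combination
  ((4 * (1 - 'X ^+ 2)) *e DDp +e (- 2 * (n%:R + 1)) *e Dq +e -2 *e Ds
    +e (2 * n%:R * 'X) *e Dp)).
by rewrite /=; ring.
Qed.

Lemma contiguous_ode_s :
  4 * (1 - 'X ^+ 2) * s^`(2) - 12 * 'X * s^`() + n%:R * (n%:R - 4) * s
    = 12 * p^`().
Proof.
case: contig => [Dp Ds Dq Dt].
have := congr1 (@deriv F) Ds; rewrite !(derivE, deriv_natr) /= => DDs.
apply: (mulfI one_sub_X2_neq0); apply: (eq_by_combination
  ((4 * (1 - 'X ^+ 2)) *e DDs +e (- 2 * (n%:R + 1)) *e Dt +e -6 *e Dp
    +e ((2 * n%:R - 4) * 'X) *e Ds)).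
by rewrite /=; ring.
Qed.

Lemma contiguous_ode4 :
  16 * ('X ^+ 2 - 1) ^+ 2 * p^`(4) + 160 * 'X * ('X ^+ 2 - 1) * p^`(3)
  - 8 * ('X ^+ 2 * (n%:R ^+ 2 - 4 * n%:R - 42) - n%:R ^+ 2 + 4 * n%:R + 18)
      * p^`(2)
  - 24 * 'X * (n%:R ^+ 2 - 4 * n%:R - 2) * p^`()
  + (n%:R - 6) * (n%:R - 2) ^+ 2 * (n%:R + 2) * p = 0.
Proof.
have ode_p := contiguous_ode_p; have ode_s := contiguous_ode_s.
have := congr1 (@deriv F) ode_p; rewrite !(derivE, deriv_natr) /= => ode_p'.
have := congr1 (@deriv F) ode_p'; rewrite !(derivE, deriv_natr) /= => ode_p''.
have := congr1 (@deriv F) ode_s; rewrite !(derivE, deriv_natr) /= => ode_s'.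
(* The derivative of [ode_s] has the form [L s' = 12 p''], where [L] is a
   second order operator.  The first three terms below apply [L] to [ode_p],
   and the last one replaces [4 L s'] by [48 p'']. *)
apply: (eq_by_combination
  ((4 * (1 - 'X ^+ 2)) *e ode_p'' +e (- 20 * 'X) *e ode_p'
    +e ((n%:R - 6) * (n%:R + 2)) *e ode_p +e 4 *e ode_s')).
by rewrite /=; ring.
Qed.

End Elimination.

End Contiguity.

(** * The companion solution *)

(** In terms of independent Gegenbauer solutions [u], [v] at even indices,
[Pm2 n] is proportional to [v_4 u_n - u_4 v_n], which vanishes at [n = 4], and
[Pm4 n] to [v_2 u_n - u_2 v_n], which vanishes at [n = 2].  The contiguity
relations couple [v_2] and [v_4], so the two sequences are differentiated
together. *)
Fixpoint Pm4 (R : realType) (n : nat) : {poly R[i]} :=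
  match n with
  | 0 => 1
  | 1 | 2 | 3 => 0
  | ((k.+2) as k2).+2 =>
      (6 + 2 * k%:R)^-1 *:
        ((4 * k%:R) *: ('X * Pm4 R k2) - (2 * (k%:R - 3)) *: Pm4 R k)
  end.

Section Companion.

Variable R : realType.

Lemma Pm2_recurrence n : recurrence n (Pm2 R n) (Pm2 R n.+2) (Pm2 R n.+4).
Proof.
by apply: recurrence_of_scale; have := Pm2_rec R n; rewrite addn4 addn2.
Qed.

Lemma Pm4_recurrence n : recurrence n (Pm4 R n) (Pm4 R n.+2) (Pm4 R n.+4).
Proof.
have n_neq0 : 6 + 2 * n%:R != 0 :> R[i] by rewrite -natrM -natrD pnatr_eq0.
by apply: recurrence_of_scale; rewrite [Pm4 R n.+4]/= scalerA mulfV // scale1r.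
Qed.

(** The system holds at [n = 0] exactly because of the initial value
[Pm4 0 = 1], which balances [Pm2 2 = 1]; at [n = 1] all four polynomials
vanish. *)
Lemma Pm2_Pm4_contiguous n :
  contiguous n (Pm2 R n) (Pm2 R n.+2) (Pm4 R n) (Pm4 R n.+2).
Proof.
elim/ltn_ind: n => [[|[|n]]] IHn.
- by split; rewrite /= ?(derivE, deriv_natr); ring.
- by split; rewrite /= ?(derivE, deriv_natr); ring.
- by apply: contiguous_step (Pm2_recurrence n) (Pm4_recurrence n) (IHn n _).
Qed.

End Companion.

Theorem theorem3p2p1 (R : realType) (n : nat) :
  16 * ('X ^+ 2 - 1) ^+ 2 * (Pm2 R n)^`(4)
  + 160 * 'X * ('X ^+ 2 - 1) * (Pm2 R n)^`(3)
  - 8 * ('X ^+ 2 * (n%:R ^+ 2 - 4 * n%:R - 42) - n%:R ^+ 2 + 4 * n%:R + 18)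
      * (Pm2 R n)^`(2)
  - 24 * 'X * (n%:R ^+ 2 - 4 * n%:R - 2) * (Pm2 R n)^`()
  + (n%:R - 6) * (n%:R - 2) ^+ 2 * (n%:R + 2) * Pm2 R n = 0.
Proof. exact: contiguous_ode4 (Pm2_Pm4_contiguous R n). Qed.
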